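(* Let $n\ge 3$, let $A_0,A_1,A_2\in\mathbb{R}^{n\times n}$ be symmetric matrices and put $q_i(x)=x^TA_ix$ for $i=0,1,2$. Suppose that there exist $\mu_1,\mu_2\in\mathbb{R}$ with $\mu_1A_1+\mu_2A_2\succ 0$, and that there exists $x^0\in\mathbb{R}^n$ with $q_1(x^0)=1$ and $q_2(x^0)<1$. Then the strict complementary condition holds at every local non-global minimizer $x^*$ of $$\min_{x\in\mathbb{R}^n}\{q_0(x):\ q_1(x)=1,\ q_2(x)\le 1\}.$$
   Context: $M\succ 0$ means that the symmetric matrix $M$ is positive definite. A local non-global minimizer is a local minimizer that is not a global minimizer. The strict complementary condition holds at a feasible point $x^*$ if there exist Lagrange multipliers $\alpha\in\mathbb{R}$ and $\beta\ge 0$ with $(A_0+\alpha A_1+\beta A_2)x^*=0$ and $\beta(q_2(x^* )-1)=0$ such that $\beta>0$ whenever $q_2(x^* )=1$ (i.e. $\beta$ and $q_2(x^* )-1$ are not both zero). *)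

(* Defs.v *)
From HB Require Import structures.
From mathcomp Require Import all_boot all_order all_algebra.
From mathcomp Require Import all_classical all_reals all_analysis.

Set Implicit Arguments.
Unset Strict Implicit.
Unset Printing Implicit Defensive.

Import Order.TTheory GRing.Theory Num.Theory.
Import numFieldNormedType.Exports.

Local Open Scope classical_set_scope.
Local Open Scope ring_scope.

Definition qform (R : realType) (n : nat) (A : 'M[R]_n) (x : 'cV[R]_n) : R :=
  (x^T *m A *m x) 0 0.

Definition symmetric_mx (R : realType) (n : nat) (A : 'M[R]_n) : Prop :=
  A^T = A.

Definition posdef_mx (R : realType) (n : nat) (A : 'M[R]_n) : Prop :=
  symmetric_mx A /\ forall x : 'cV[R]_n, x != 0 -> 0 < qform A x.

Definition global_minimizer (R : realType) (T : Type)
    (D : set T) (f : T -> R) (x : T) : Prop :=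
  D x /\ forall y, D y -> f x <= f y.

Definition local_minimizer (R : realType) (T : topologicalType)
    (D : set T) (f : T -> R) (x : T) : Prop :=
  D x /\ \forall y \near x, D y -> f x <= f y.

Definition local_nonglobal_minimizer (R : realType) (T : topologicalType)
    (D : set T) (f : T -> R) (x : T) : Prop :=
  local_minimizer D f x /\ ~ global_minimizer D f x.

Definition feasible_set (R : realType) (n : nat) (A1 A2 : 'M[R]_n) :
    set 'cV[R]_n :=
  [set x | qform A1 x = 1 /\ qform A2 x <= 1].

Definition strict_complementary (R : realType) (n : nat)
    (A0 A1 A2 : 'M[R]_n) (x : 'cV[R]_n) : Prop :=
  exists alpha beta : R,
    [/\ 0 <= beta,
        (A0 + alpha *: A1 + beta *: A2) *m x = 0,
        beta * (qform A2 x - 1) = 0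
      & qform A2 x = 1 -> 0 < beta].

(* Main.v *)
Require Import Defs.
From mathcomp Require Import all_boot all_order all_algebra.
From mathcomp Require Import all_classical all_reals all_analysis.
From mathcomp Require Import ring lra.

Set Implicit Arguments.
Unset Strict Implicit.
Unset Printing Implicit Defensive.

Import Order.TTheory GRing.Theory Num.Theory.
Import numFieldNormedType.Exports.

Local Open Scope classical_set_scope.
Local Open Scope ring_scope.

(** Both constraints are quadratic forms compared with the same number 1, so
    the problem is a homogeneous one in disguise.  Write [v] for the value
    q_0(x) at the local minimizer [x], B = A_2 - A_1 and C = A_0 - v A_1.
    Where q_1 = 1, feasibility reads q_B <= 0 and the inequality q_0 >= v
    reads q_C >= 0.  Rescaling a point near [x] to the surface q_1 = 1 shows
    that along every ray from [x], and close to [x], q_B <= 0 implies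
    q_C >= 0 ([local_min_along_ray]); and if q_C >= 0 holds on the whole cone q_B <= 0,
    [x] is a global minimizer ([global_minimizer_of_cone]).

    Suppose the constraint is active, i.e. q_B(x) = 0 = q_C(x).
    - If Bx = 0, then q_B(x + td) = t^2 q_B(d), so the rays x + td and x - td
      stay in the cone whenever q_B(d) <= 0; adding the two resulting
      inequalities cancels the linear term and leaves q_C(d) >= 0.  Hence [x]
      is global.
    - If Bx <> 0, the constraint is qualified and Farkas' lemma for a single
      vector gives Cx = - beta Bx with beta >= 0.  When beta = 0, also
      Cx = 0 and q_C(x + td) = t^2 q_C(d).  Every d not orthogonal to Bx
      points, up to sign, into the cone, so q_C(d) >= 0 for these d, hence
      for all d by density, and [x] is again global.
    A non-global local minimizer therefore has beta > 0.  When the constraint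
    is inactive every direction is feasible, so Cx = 0 and beta = 0 works. *)

(** * Inner product and quadratic forms along a line *)

Definition dotmx (R : realType) (n : nat) (u v : 'cV[R]_n) : R :=
  (u^T *m v) 0 0.

Lemma dotmxE (R : realType) (n : nat) (u v : 'cV[R]_n) :
  dotmx u v = \sum_i u i 0 * v i 0.
Proof. by rewrite /dotmx mxE; apply: eq_bigr => i _; rewrite mxE. Qed.

Lemma dotmxC (R : realType) (n : nat) (u v : 'cV[R]_n) : dotmx u v = dotmx v u.
Proof. by rewrite !dotmxE; apply: eq_bigr => i _; rewrite mulrC. Qed.

Lemma dotmxDr (R : realType) (n : nat) (u v w : 'cV[R]_n) :
  dotmx u (v + w) = dotmx u v + dotmx u w.
Proof. by rewrite /dotmx mulmxDr mxE. Qed.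

Lemma dotmxZr (R : realType) (n : nat) a (u v : 'cV[R]_n) :
  dotmx u (a *: v) = a * dotmx u v.
Proof. by rewrite /dotmx -scalemxAr mxE. Qed.

Lemma dotmxNr (R : realType) (n : nat) (u v : 'cV[R]_n) :
  dotmx u (- v) = - dotmx u v.
Proof. by rewrite -scaleN1r dotmxZr mulN1r. Qed.

Lemma dotmxDl (R : realType) (n : nat) (u v w : 'cV[R]_n) :
  dotmx (u + v) w = dotmx u w + dotmx v w.
Proof. by rewrite dotmxC dotmxDr !(dotmxC w). Qed.

Lemma dotmxZl (R : realType) (n : nat) a (u v : 'cV[R]_n) :
  dotmx (a *: u) v = a * dotmx u v.
Proof. by rewrite dotmxC dotmxZr dotmxC. Qed.

Lemma dotmxNl (R : realType) (n : nat) (u v : 'cV[R]_n) :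
  dotmx (- u) v = - dotmx u v.
Proof. by rewrite dotmxC dotmxNr dotmxC. Qed.

Lemma dotmx_ge0 (R : realType) (n : nat) (u : 'cV[R]_n) : 0 <= dotmx u u.
Proof. by rewrite dotmxE; apply: sumr_ge0 => i _; rewrite -expr2 sqr_ge0. Qed.

Lemma dotmx_eq0 (R : realType) (n : nat) (u : 'cV[R]_n) :
  dotmx u u = 0 -> u = 0.
Proof.
rewrite dotmxE => /eqP; rewrite psumr_eq0; last first.
  by move=> i _; rewrite -expr2 sqr_ge0.
move=> /allP h; apply/colP => i; rewrite mxE.
by have := h i (mem_index_enum i); rewrite /= mulf_eq0 orbb => /eqP.
Qed.

Lemma qformE (R : realType) (n : nat) (A : 'M[R]_n) (x : 'cV[R]_n) :
  qform A x = dotmx x (A *m x).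
Proof. by rewrite /qform /dotmx mulmxA. Qed.

Lemma qformZ (R : realType) (n : nat) (A : 'M[R]_n) a (x : 'cV[R]_n) :
  qform A (a *: x) = a ^+ 2 * qform A x.
Proof. by rewrite !qformE -scalemxAr dotmxZr dotmxZl mulrA. Qed.

Lemma qformB (R : realType) (n : nat) (A B : 'M[R]_n) (x : 'cV[R]_n) :
  qform (A - B) x = qform A x - qform B x.
Proof. by rewrite !qformE mulmxBl dotmxDr dotmxNr. Qed.

Lemma qformZm (R : realType) (n : nat) a (A : 'M[R]_n) (x : 'cV[R]_n) :
  qform (a *: A) x = a * qform A x.
Proof. by rewrite !qformE -scalemxAl dotmxZr. Qed.

Lemma dotmx_sym (R : realType) (n : nat) (A : 'M[R]_n) (x y : 'cV[R]_n) :
  symmetric_mx A -> dotmx x (A *m y) = dotmx y (A *m x).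
Proof. by move=> sA; rewrite dotmxC /dotmx trmx_mul sA -mulmxA. Qed.

Lemma qform_ray (R : realType) (n : nat) (A : 'M[R]_n) (x d : 'cV[R]_n) t :
  symmetric_mx A ->
  qform A (x + t *: d)
    = qform A x + t * (2 * dotmx d (A *m x)) + t ^+ 2 * qform A d.
Proof.
move=> sA; rewrite !qformE mulmxDr -scalemxAr.
rewrite !(dotmxDl, dotmxDr, dotmxZl, dotmxZr) (dotmx_sym x d sA); ring.
Qed.

(** A one-vector Farkas lemma.  The multiplier is the projection coefficient
    of [- c] on [b]; the residual [c + beta b] vanishes because its opposite,
    tilted slightly by [- b], would be an admissible direction. *)
Lemma farkas1 (R : realType) (n : nat) (b c : 'cV[R]_n) : b != 0 ->
  (forall d, dotmx d b < 0 -> 0 <= dotmx d c) ->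
  exists2 beta, 0 <= beta & c + beta *: b = 0.
Proof.
move=> b0 h.
have bb : 0 < dotmx b b.
  rewrite lt_neqAle dotmx_ge0 andbT eq_sym.
  by apply: contra b0 => /eqP /dotmx_eq0 ->.
set beta := - dotmx b c / dotmx b b; exists beta.
  have : 0 <= dotmx (- b) c by apply: h; rewrite dotmxNl oppr_lt0.
  by rewrite dotmxNl => ?; apply: divr_ge0 => //; exact: ltW.
pose r := c + beta *: b; rewrite -/r.
have rb : dotmx r b = 0.
  by rewrite dotmxDl dotmxZl (dotmxC c) /beta mulfVK ?gt_eqF// subrr.
have rc : dotmx r c = dotmx r r by rewrite [RHS]dotmxDr dotmxZr rb mulr0 addr0.
clearbody r.
apply: dotmx_eq0; apply/eqP; rewrite eq_le dotmx_ge0 andbT.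
apply/ler_addgt0Pr => e e0; rewrite add0r -rc.
(* The tilt is small enough that its effect on [dotmx _ c] is at most [e]. *)
pose k := e / (`|dotmx b c| + 1).
have k0 : 0 < k by apply: divr_gt0 => //; apply: ltr_wpDl.
have := h (- r - k *: b).
rewrite !(dotmxDl, dotmxNl, dotmxZl) rb oppr0 add0r oppr_lt0 => /(_ _).
rewrite mulr_gt0// => /(_ isT) hk.
have : k * - dotmx b c <= k * (`|dotmx b c| + 1).
  rewrite ler_pM2l//; apply: (le_trans (ler_norm _)).
  by rewrite normrN lerDl.
rewrite /k mulfVK; first by rewrite -/k; lra.
by apply: lt0r_neq0; apply: ltr_wpDl.
Qed.

(** * Sign of a quadratic polynomial near zero *)

Lemma quad_cvg (R : realType) (a b c : R) :
  (fun t => a + t * b + t ^+ 2 * c) @ 0^'+ --> a.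
Proof.
have : {for 0, continuous (fun t : R => a + t * b + t ^+ 2 * c)}.
  apply: cvgD; first (apply: cvgD; first exact: cvg_cst).
    by apply: cvgMl; exact: cvg_id.
  by apply: cvgMl; exact: exprn_continuous.
rewrite /prop_for /continuous_at mul0r expr0n mul0r !addr0.
exact: cvg_at_right_filter.
Qed.

Lemma quad_lt0_near (R : realType) (a b c : R) : a < 0 ->
  \forall t \near 0^'+, a + t * b + t ^+ 2 * c < 0.
Proof. by move=> a0; apply: cvgr_lt (@quad_cvg R a b c) _ a0. Qed.

Lemma quad0_lt0_near (R : realType) (b c : R) : b < 0 ->
  \forall t \near 0^'+, 0 + t * b + t ^+ 2 * c < 0.
Proof.
move=> b0; have := quad_lt0_near c 0 b0.
apply: filterS2 (nbhs_right_gt 0) => t t0 h.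
rewrite (_ : _ + _ = t * (b + t * c + t ^+ 2 * 0)); last by ring.
by rewrite pmulr_rlt0.
Qed.

Lemma quad_ge0 (R : realType) (a b c : R) :
  (\forall t \near 0^'+, 0 <= a + t * b + t ^+ 2 * c) -> 0 <= a.
Proof.
move=> h; rewrite leNgt; apply/negP => /(quad_lt0_near b c) h'.
by have [t []] := filter_ex (filterI h h'); rewrite leNgt => /negP.
Qed.

Lemma quad0_ge0 (R : realType) (b c : R) :
  (\forall t \near 0^'+, 0 <= 0 + t * b + t ^+ 2 * c) -> 0 <= b.
Proof.
move=> h; rewrite leNgt; apply/negP => /(quad0_lt0_near c) h'.
by have [t []] := filter_ex (filterI h h'); rewrite leNgt => /negP.
Qed.

Lemma quad00_ge0 (R : realType) (c : R) :
  (\forall t \near 0^'+, 0 <= t ^+ 2 * c) -> 0 <= c.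
Proof.
move=> h; have [t [tc t0]] := filter_ex (filterI h (nbhs_right_gt 0)).
by rewrite -(pmulr_rge0 _ (exprn_gt0 2 t0)).
Qed.

(** A form that is nonnegative off a hyperplane is nonnegative everywhere:
    perturb a vector of the hyperplane along the normal [b]. *)
Lemma qform_ge0_off_hyperplane (R : realType) (n : nat) (C : 'M[R]_n)
    (b : 'cV[R]_n) : symmetric_mx C -> b != 0 ->
  (forall d, dotmx d b != 0 -> 0 <= qform C d) -> forall d, 0 <= qform C d.
Proof.
move=> sC b0 h d; have [db|/h//] := eqVneq (dotmx d b) 0.
apply: (@quad_ge0 _ _ (2 * dotmx b (C *m d)) (qform C b)).
apply: filterS (nbhs_right_gt 0) => t t0; rewrite -qform_ray//; apply: h.
rewrite dotmxDl dotmxZl db add0r mulf_eq0 gt_eqF//=.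
by apply: contra b0 => /eqP /dotmx_eq0 ->.
Qed.

(** * Homogenization of the problem *)

Lemma normalized_ray_cvg (R : realType) (n : nat) (A : 'M[R]_n)
    (x d : 'cV[R]_n) : symmetric_mx A -> qform A x = 1 ->
  (fun t : R => (Num.sqrt (qform A (x + t *: d)))^-1 *: (x + t *: d))
    @ 0^'+ --> x.
Proof.
move=> sA qx.
have q1 : (fun t : R => qform A (x + t *: d)) @ 0^'+ --> (1 : R).
  under eq_fun do rewrite qform_ray// qx.
  exact: (@quad_cvg _ _ _ _).
have s1 : (fun t : R => (Num.sqrt (qform A (x + t *: d)))^-1) @ 0^'+ --> (1 : R).
  rewrite -[X in _ --> X]invr1; apply: cvgV; first exact: oner_neq0.
  rewrite -[X in _ --> X](@sqrtr1 R).
  by apply: continuous_cvg => //; exact: sqrt_continuous.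
have r1 : (fun t : R => x + t *: d) @ 0^'+ --> x.
  rewrite -[X in _ --> X]addr0; apply: cvgD; first exact: cvg_cst.
  rewrite -[X in _ --> X](scale0r d).
  apply: cvgZ; last exact: cvg_cst.
  by apply: cvg_at_right_filter; exact: cvg_id.
by rewrite -[X in _ --> X]scale1r; apply: cvgZ.
Qed.

(** Rescaling turns the local minimality of [x] on the surface q_1 = 1 into a
    statement on the cone q_2 - q_1 <= 0; normalizing is possible because
    q_1 stays close to 1. *)
Lemma local_min_along_ray (R : realType) (n : nat) (A0 A1 A2 : 'M[R]_n)
    (x d : 'cV[R]_n) : symmetric_mx A1 ->
  local_minimizer (feasible_set A1 A2) (qform A0) x ->
  \forall t \near 0^'+, qform (A2 - A1) (x + t *: d) <= 0 ->
    0 <= qform (A0 - qform A0 x *: A1) (x + t *: d).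
Proof.
move=> sA1 [[qx _] hmin].
have pos : \forall t \near (0 : R)^'+, 0 < qform A1 (x + t *: d).
  under eq_near do rewrite qform_ray// qx.
  by apply: cvgr_gt (@quad_cvg _ _ _ _) _ ltr01.
apply: filterS2 pos (normalized_ray_cvg d sA1 qx hmin) => t.
set y := x + t *: d; set q := qform A1 y => q0 /=.
have s2 : (Num.sqrt q)^-1 ^+ 2 = q^-1 by rewrite exprVn sqr_sqrtr// ltW.
rewrite /feasible_set /= !qformZ !s2 -/q mulVf ?gt_eqF// => hm.
rewrite !qformB qformZm -/q subr_le0 subr_ge0 => q2.
rewrite -ler_pdivlMr// mulrC; apply: hm; split => //.
by rewrite ler_pdivrMl// mulr1.
Qed.

Lemma global_minimizer_of_cone (R : realType) (n : nat) (A0 A1 A2 : 'M[R]_n)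
    (x : 'cV[R]_n) : feasible_set A1 A2 x ->
  (forall d, qform (A2 - A1) d <= 0 ->
    0 <= qform (A0 - qform A0 x *: A1) d) ->
  global_minimizer (feasible_set A1 A2) (qform A0) x.
Proof.
move=> fx h; split=> // y [y1 y2]; have := h y.
by rewrite !qformB qformZm y1 mulr1 subr_le0 subr_ge0; apply.
Qed.

(** * Strict complementarity *)

Theorem theorem4p1 (R : realType) (n : nat) (hn : (3 <= n)%N)
    (A0 A1 A2 : 'M[R]_n)
    (hA0 : symmetric_mx A0) (hA1 : symmetric_mx A1) (hA2 : symmetric_mx A2)
    (hpd : exists mu1 mu2 : R, posdef_mx (mu1 *: A1 + mu2 *: A2))
    (hslater : exists x0 : 'cV[R]_n, qform A1 x0 = 1 /\ qform A2 x0 < 1)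
    (xstar : 'cV[R]_n)
    (hx : local_nonglobal_minimizer (feasible_set A1 A2) (qform A0) xstar) :
  strict_complementary A0 A1 A2 xstar.
Proof.
have [hloc hnonglob] := hx; have [[x1 x2] _] := hloc.
move: xstar x1 x2 hloc hnonglob {hx} => x x1 x2 hloc hnonglob.
set v := qform A0 x; pose B := A2 - A1; pose C := A0 - v *: A1.
have sB : symmetric_mx B by rewrite /symmetric_mx /B linearB /= hA1 hA2.
have sC : symmetric_mx C.
  by rewrite /symmetric_mx /C linearB linearZ /= hA0 hA1.
have Cx0 : qform C x = 0 by rewrite /C qformB qformZm x1 mulr1 subrr.
have qB : qform B x = qform A2 x - 1 by rewrite /B qformB x1.
have hray d : \forall t \near 0^'+, qform B (x + t *: d) <= 0 ->
    0 <= qform C (x + t *: d) := local_min_along_ray d hA1 hloc.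
have strict_dir d : (\forall t \near 0^'+, qform B (x + t *: d) <= 0) ->
    0 <= dotmx d (C *m x).
  move=> hB; rewrite -(pmulr_rge0 _ (ltr0Sn R 1)).
  apply: (@quad0_ge0 _ _ (qform C d)); apply: filterS2 (hray d) hB.
  by move=> t /[apply]; rewrite qform_ray// Cx0.
have kkt beta : C *m x + beta *: (B *m x) = 0 ->
    (A0 + (- v - beta) *: A1 + beta *: A2) *m x = 0.
  rewrite scalemxAl -mulmxDl => <-; congr (_ *m x); rewrite /C /B.
  by apply/matrixP => i j; rewrite !mxE; ring.
have global_false : (forall d, qform B d <= 0 -> 0 <= qform C d) -> False.
  by move=> h; apply/hnonglob/global_minimizer_of_cone; case: hloc.
have [inactive|active|/eqP active] := ltgtP (qform A2 x) 1; first 1 last.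
- by move: x2; rewrite leNgt active.
- have qB0 : qform B x = 0 by rewrite qB (eqP active) subrr.
  have [Bx0|Bx0] := eqVneq (B *m x) 0.
    exfalso; apply: global_false => d Bd.
    have stay e : qform B e <= 0 ->
        \forall t \near (0 : R)^'+, 0 <= qform C (x + t *: e).
      move=> Be; apply: filterS (hray e) => t; apply.
      rewrite qform_ray// qB0 Bx0 /dotmx mulmx0 mxE !mulr0 !add0r.
      by apply: mulr_ge0_le0 => //; exact: sqr_ge0.
    have BNd : qform B (- d) <= 0 by rewrite -scaleN1r qformZ sqrrN expr1n mul1r.
    apply: quad00_ge0; apply: filterS2 (stay _ Bd) (stay _ BNd) => t.
    rewrite !qform_ray// Cx0 dotmxNl -(scaleN1r d) qformZ sqrrN expr1n mul1r.
    lra.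
  have inward d : dotmx d (B *m x) < 0 ->
      \forall t \near 0^'+, qform B (x + t *: d) <= 0.
    move=> db; have db2 : 2 * dotmx d (B *m x) < 0 by rewrite pmulr_rlt0.
    apply: filterS (quad0_lt0_near (qform B d) db2) => t /ltW.
    by rewrite qform_ray// qB0.
  have [|beta beta0 hbeta] := @farkas1 _ _ (B *m x) (C *m x) Bx0.
    by move=> d db; apply/strict_dir/inward.
  exists (- v - beta), beta; split => //; first exact: kkt.
    by rewrite (eqP active) subrr mulr0.
  move=> _; rewrite lt_neqAle beta0 andbT eq_sym; apply/eqP => bz.
  move: hbeta; rewrite bz scale0r addr0 => Cx.
  have inC d : dotmx d (B *m x) < 0 -> 0 <= qform C d.
    move=> db; apply: quad00_ge0; apply: filterS2 (hray d) (inward d db) => t.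
    move=> /[apply].
    by rewrite qform_ray// Cx0 Cx /dotmx mulmx0 mxE !mulr0 !add0r.
  apply: global_false => d _; move: d.
  apply: (qform_ge0_off_hyperplane sC Bx0) => d.
  rewrite neq_lt => /orP[/inC//|db].
  have := inC (- d); rewrite dotmxNl oppr_lt0 => /(_ db).
  by rewrite -scaleN1r qformZ sqrrN expr1n mul1r.
- exists (- v - 0), 0; split => //; last first.
  + by move=> e; move: inactive; rewrite e ltxx.
  + by rewrite mul0r.
  apply: kkt; rewrite scale0r addr0.
  (* Every direction enters the cone, in particular the one opposite to Cx. *)
  apply: dotmx_eq0; apply/eqP; rewrite eq_le dotmx_ge0 andbT -oppr_ge0 -dotmxNl.
  apply: strict_dir; have qBneg : qform B x < 0 by rewrite qB subr_lt0.
  set d := - (C *m x).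
  apply: filterS (quad_lt0_near (2 * dotmx d (B *m x)) (qform B d) qBneg) => t.
  by move=> /ltW; rewrite qform_ray.
Qed.
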